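(* Let $R$ and $R'$ be finite commutative rings with non-zero identities. Then $\mathfrak{J}_R\cong\mathfrak{J}_{R'}$ (as graphs) if and only if $|J(R)|=|J(R')|$ and $R/J(R)\cong R'/J(R')$ (as rings).
   Context: For a commutative ring $R$ with non-zero identity, $J(R)$ denotes its Jacobson radical (the intersection of all maximal ideals) and $U(R)$ its group of units. The Jacobson graph $\mathfrak{J}_R$ is the simple graph with vertex set $R\setminus J(R)$ in which two distinct vertices $x,y$ are adjacent if and only if $1-xy\notin U(R)$. A graph isomorphism is a bijection between vertex sets that preserves adjacency and non-adjacency. *)

(* Defs.v *)
From HB Require Import structures.
From mathcomp Require Import all_boot all_order all_algebra.
From mathcomp Require Import ring_quotient.

Set Implicit Arguments.
Unset Strict Implicit.
Unset Printing Implicit Defensive.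

Import GRing.Theory.
Local Open Scope ring_scope.

Record simple_graph := SimpleGraph {
  vertex :> finType;
  adj : rel vertex;
  adj_sym : symmetric adj;
  adj_irrefl : irreflexive adj }.

Definition graph_iso (G H : simple_graph) : Prop :=
  exists f : G -> H, bijective f /\ {mono f : x y / adj x y}.

Definition ring_iso (A B : nzRingType) : Prop :=
  exists f : {rmorphism A -> B}, bijective f.

Section JacobsonRadical.

Variable R : finComUnitRingType.

(* Boolean form of the library's idealr_closed (see proper_idealP), needed to
   index an intersection over {set R}; as there, ideals are proper. *)
Definition proper_ideal_set (I : {set R}) : bool :=
  [&& 0 \in I, 1 \notin I
    & [forall a, forall u in I, forall v in I, a * u + v \in I]].

Lemma proper_idealP (I : {set R}) :
  reflect (idealr_closed (mem I)) (proper_ideal_set I).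
Proof.
apply: (iffP and3P) => [[I0 I1 Il]|[I0 I1 Il]]; split=> //.
  by move=> a u v Iu Iv; move/forallP/(_ a)/forall_inP/(_ u Iu)/forall_inP: Il; exact.
apply/forallP=> a; apply/forall_inP=> u Iu; apply/forall_inP=> v Iv.
exact: Il.
Qed.

Definition maximal_ideal (I : {set R}) : bool := maxset proper_ideal_set I.

Definition jacobson : {set R} := \bigcap_(I : {set R} | maximal_ideal I) I.

Lemma proper_ideal0 : proper_ideal_set [set 0].
Proof.
apply/and3P; split; rewrite ?inE ?oner_eq0 //.
apply/forallP=> a; apply/forall_inP=> u /set1P->.
by apply/forall_inP=> v /set1P->; rewrite mulr0 addr0 inE.
Qed.

Definition in_jacobson : pred R := fun x => x \in jacobson.

Lemma jacobson_idealr_closed : idealr_closed in_jacobson.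
Proof.
split.
- by rewrite unfold_in; apply/bigcapP=> I /maxsetp/proper_idealP[].
- have [M Mmax _] := maxset_exists proper_ideal0.
  rewrite unfold_in; apply/negP=> /bigcapP/(_ M Mmax).
  by have /proper_idealP[_ /negP] := maxsetp Mmax.
move=> a u v; rewrite !unfold_in => /bigcapP Ju /bigcapP Jv; apply/bigcapP=> I Imax.
have /proper_idealP[_ _ Il] := maxsetp Imax.
by apply: Il; [apply: Ju | apply: Jv].
Qed.

HB.instance Definition _ :=
  isIdealr.Build R in_jacobson jacobson_idealr_closed.

Definition jacobson_ideal : idealr R := in_jacobson.

Definition jacobson_quot : comNzRingType := {ideal_quot jacobson_ideal}.

End JacobsonRadical.

Section JacobsonGraph.

Variable R : finComUnitRingType.

Definition jacobson_vertex : finType := {x : R | x \notin jacobson R}.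

Definition jacobson_adj : rel jacobson_vertex := fun x y =>
  (x != y) && (1 - val x * val y \isn't a GRing.unit).

Lemma jacobson_adj_sym : symmetric jacobson_adj.
Proof. by move=> x y; rewrite /jacobson_adj eq_sym mulrC. Qed.

Lemma jacobson_adj_irrefl : irreflexive jacobson_adj.
Proof. by move=> x; rewrite /jacobson_adj eqxx. Qed.

Definition jacobson_graph : simple_graph :=
  SimpleGraph jacobson_adj_sym jacobson_adj_irrefl.

End JacobsonGraph.

(* Main.v *)
Require Import Defs.
From mathcomp Require Import all_boot all_order all_algebra.
From HB Require Import structures.
From mathcomp Require Import all_fingroup all_solvable all_field.
From mathcomp Require Import generic_quotient ring_quotient ring zify.

Set Implicit Arguments.
Unset Strict Implicit.
Unset Printing Implicit Defensive.

Import Order.TTheory GRing.Theory Num.Theory.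
Local Open Scope ring_scope.

(* Let [n = #|R|] and, for [x] in [R], let [supp x] be the set of maximal ideals
   not containing [x]. The number of [y] with [1 - x y] not a unit is at least
   [#|M|] for every [M] in [supp x], with equality iff [supp x = [set M]]; the
   degree of a vertex [x] is this number, minus 1 if [1 - x ^ 2] is not a unit.
   So the least degree is [D - 1], where [D] is the least size of a maximal ideal,
   and since [D] divides [n] and [0 < #|J(R)| <= D], the number [n - #|J(R)|] of
   vertices determines [#|J(R)|] and [n].
   By the Chinese remainder theorem, the number of [x] of given degree with
   [supp x = T] depends only on [n], [#|J(R)|] and the sizes of the members of [T].
   If [supp x] has a member of size at least [s] and [x] has degree [s - 1], then
   [supp x = [set M]] with [#|M| = s]; so by induction on [s] the number of
   vertices of degree [s - 1] determines the number of maximal ideals of size [s].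
   Hence the sizes of the residue fields, and so the ring R/J(R), are determined. *)

(** * Factoring ring morphisms, finite fields of equal size, matching of fibres *)

(** [h b] is [g] of a chosen preimage of [b]. Two preimages differ by an element of the kernel of
    [f], which [g] kills, so the choice is immaterial and [h] inherits the ring laws. *)
Lemma surj_rmorphism_factor (A B C : comNzRingType) (f : {rmorphism A -> B})
    (g : {rmorphism A -> C}) :
  (forall b, exists a, f a == b) -> (forall a, f a = 0 -> g a = 0) ->
  exists h : {rmorphism B -> C}, forall a, h (f a) = g a.
Proof.
move=> fsurj fg.
pose s b := xchoose (fsurj b).
have sK b : f (s b) = b by apply/eqP; exact: (xchooseP (fsurj b)).
have hE a b : f a = b -> g (s b) = g a.
  move=> fab; apply/eqP; rewrite -subr_eq0 -rmorphB fg //.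
  by rewrite rmorphB sK fab subrr.
pose h b := g (s b).
have hB : zmod_morphism h.
  by move=> x y; rewrite /h -rmorphB; apply: hE; rewrite rmorphB !sK.
have hM : monoid_morphism h.
  split; first by rewrite /h -(rmorph1 g); apply: hE; rewrite rmorph1.
  by move=> x y; rewrite /h -rmorphM; apply: hE; rewrite rmorphM !sK.
pose H : {rmorphism B -> C} :=
  HB.pack h (GRing.isZmodMorphism.Build _ _ h hB)
            (GRing.isMonoidMorphism.Build _ _ h hM).
by exists H => a; apply: hE.
Qed.

Lemma finField_cyclic_gen (K : finFieldType) :
  exists z : K, forall x, x != 0 -> exists k, x = z ^+ k.
Proof.
have /cyclicP[u Gu] := field_unit_group_cyclic [set: {unit K}]%G.
exists (val u) => x nzx.
have : finField_unit nzx \in <[u]>%g by rewrite -Gu inE.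
case/cycleP=> k /(congr1 val); rewrite /= => ->.
by exists k; rewrite FinRing.val_unitX.
Qed.

(** The minimal polynomial [q] over the prime field of a generator [z] of the units of [K] divides
    ['X^#|K| - 'X], which splits over [K'] because [K'] has the same size; so [q] has a root [z']
    there. Evaluation at [z] is onto and kills only multiples of [q], so evaluation at [z'] factors
    through it. *)
Lemma finField_iso (K K' : finFieldType) :
  #|K| = #|K'| -> exists f : {rmorphism K -> K'}, bijective f.
Proof.
move=> cardK.
have [p p_pr Kp] := finPcharP K.
have K'p : p \in [pchar K'].
  apply: (card_finPcharP (n := logn p #|K|)) => //.
  by rewrite -cardK; exact: (card_pprimeChar Kp).
pose L := pPrimeCharType Kp; pose L' := pPrimeCharType K'p.
have [z zgen] := finField_cyclic_gen K.
have /polyOver1P[q qE] := minPolyOver (1%AS : {subfield L}) (z : L).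
have qdvd (P : {poly 'F_p}) : root (map_poly (in_alg L) P) (z : L) -> q %| P.
  move=> Pz; rewrite -(dvdp_map (in_alg L)) -qE minPoly_dvdp //.
  by apply/polyOver1P; exists P.
have q_root : root (map_poly (in_alg L) q) (z : L).
  by rewrite -qE root_minPoly.
have qX : q %| 'X^#|K| - 'X.
  apply: qdvd; rewrite rmorphB /= map_polyXn map_polyX rootE !hornerE.
  by rewrite (expf_card (z : K)) subrr.
have [z' z'root] : exists z' : L', root (map_poly (in_alg L') q) z'.
  have : map_poly (in_alg L') q %| \prod_(x : K') ('X - (x : L')%:P).
    have -> : \prod_(x : K') ('X - (x : L')%:P) =
              map_poly (in_alg L') ('X^#|K| - 'X).
      by rewrite rmorphB /= map_polyXn map_polyX cardK -(finField_genPoly K').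
    by rewrite dvdp_map.
  case/dvdp_prod_XsubC => m qm.
  (* A non-constant divisor of a product of linear factors retains at least one of them, hence has a
     root. *)
  have sq : size (map_poly (in_alg L') q) != 1.
    rewrite size_map_poly -(size_map_poly (in_alg L)) -qE size_minPoly.
    by rewrite eqSS -lt0n adjoin_degreeE divn_gt0 ?adim_gt0 ?dimvS ?subv_adjoin.
  case E : (mask m (index_enum K')) qm => [|z' s] qm.
    by rewrite (eqp_size qm) big_nil size_poly1 in sq.
  exists z'; rewrite (eqp_root qm) big_cons rootM root_XsubC eqxx //.
pose f := horner_alg (z : L) : {rmorphism {poly 'F_p} -> L}.
pose g := horner_alg (z' : L') : {rmorphism {poly 'F_p} -> L'}.
have [||h _] := @surj_rmorphism_factor {poly 'F_p} L L' f g.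
- move=> x; have [->|nzx] := eqVneq x 0; first by exists 0; rewrite rmorph0.
  have [k ->] := zgen x nzx.
  by exists 'X^k; rewrite rmorphXn /= /f /= horner_algX.
- move=> P /eqP Pz; have /dvdpP[r ->] : q %| P by apply: qdvd.
  rewrite rmorphM /= [X in _ * X](_ : _ = 0) ?mulr0 //.
  by apply/eqP; exact: z'root.
exists (h : {rmorphism K -> K'}); apply: inj_card_bij; first exact: fmorph_inj.
by rewrite cardK.
Qed.

(** The [i]-th element of each fibre of [f] in [A] is sent to the [i]-th element of the fibre of [g]
    over the same key. [y0] is only a default for [nth], never reached on [A]. *)
Lemma fiber_bij_in (T T' : finType) (K : eqType) (A : {set T}) (B : {set T'})
    (f : T -> K) (g : T' -> K) (y0 : T') :
  (forall k, #|[set x in A | f x == k]| = #|[set y in B | g y == k]|) ->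
  exists s : T -> T',
    [/\ {in A &, injective s}, s @: A = B & {in A, forall x, g (s x) = f x}].
Proof.
move=> cardAB.
pose FA k := enum [set x in A | f x == k].
pose FB k := enum [set y in B | g y == k].
have sAB k : size (FA k) = size (FB k) by rewrite -!cardE cardAB.
pose s x := nth y0 (FB (f x)) (index x (FA (f x))).
have inFA x : x \in A -> x \in FA (f x) by move=> Ax; rewrite mem_enum !inE Ax /=.
have inFB x : x \in A -> s x \in FB (f x).
  by move=> Ax; apply: mem_nth; rewrite -sAB index_mem inFA.
have gs : {in A, forall x, g (s x) = f x}.
  by move=> x /inFB; rewrite mem_enum !inE => /andP[_ /eqP].
exists s; split=> //.
  move=> x y Ax Ay sxy; have fxy : f x = f y by rewrite -!gs ?sxy.
  have FAy : y \in FA (f x) by rewrite fxy inFA.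
  suff ixy : index x (FA (f x)) = index y (FA (f x)).
    by rewrite -[x](nth_index x (inFA x Ax)) ixy nth_index.
  apply/eqP; rewrite -(@nth_uniq _ y0 (FB (f x))) ?enum_uniq // -?sAB ?index_mem ?inFA //.
  by move: sxy; rewrite /s -fxy => ->.
apply/setP=> y; apply/imsetP/idP => [[x Ax ->]|By].
  by have := inFB x Ax; rewrite mem_enum !inE => /andP[].
have FBy : y \in FB (g y) by rewrite mem_enum !inE By /=.
have := FBy; rewrite -index_mem -sAB.
(* The fibre of [f] over [g y] is not empty; its head [x0] is the default that [nth] needs. *)
case FAE: (FA (g y)) => [//|x0 l]; rewrite -FAE => lt_iy.
have := mem_nth x0 lt_iy; set x := nth x0 _ _ => FAx.
have := FAx; rewrite mem_enum !inE => /andP[Ax /eqP fx].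
by exists x => //; rewrite /s fx index_uniq ?enum_uniq // nth_index.
Qed.

(** * Maximal ideals as subsets: units, primality, separation *)

Section MaximalIdeals.

Variable R : finComUnitRingType.
Implicit Types (M I : {set R}) (x y : R).

Lemma maximal_proper M : maximal_ideal M -> proper_ideal_set M.
Proof. exact: maxsetp. Qed.

Lemma properDM I a u v : proper_ideal_set I -> u \in I -> v \in I -> a * u + v \in I.
Proof. by case/proper_idealP=> _ _; apply. Qed.

Lemma maximal1 M : maximal_ideal M -> 1 \notin M.
Proof. by case/maximal_proper/proper_idealP. Qed.

Lemma maximal0 M : maximal_ideal M -> 0 \in M.
Proof. by case/maximal_proper/proper_idealP. Qed.

Lemma maximalD M : maximal_ideal M -> {in M &, forall x y, x + y \in M}.
Proof. by move=> Mmax x y Mx My; rewrite -[x]mul1r properDM ?maximal_proper. Qed.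

Lemma maximalMr M a : maximal_ideal M -> {in M, forall x, a * x \in M}.
Proof. by move=> Mm x Mx; rewrite -[_ * _]addr0 properDM ?maximal0 ?maximal_proper. Qed.

Lemma maximalMl M a : maximal_ideal M -> {in M, forall x, x * a \in M}.
Proof. by move=> Mm x Mx; rewrite mulrC maximalMr. Qed.

Lemma maximalN M : maximal_ideal M -> {in M, forall x, - x \in M}.
Proof. by move=> Mm x Mx; rewrite -mulN1r maximalMr. Qed.

Lemma maximalB M : maximal_ideal M -> {in M &, forall x y, x - y \in M}.
Proof. by move=> Mm x y Mx My; rewrite maximalD ?maximalN. Qed.

(** A non-unit [x] generates a proper ideal [I], which lies in a maximal one. *)
Lemma nonunit_maximal x :
  reflect (exists2 M, maximal_ideal M & x \in M) (x \isn't a GRing.unit).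
Proof.
apply: (iffP idP) => [Nx|[M Mmax Mx]]; last first.
  apply/negP=> Ux; have /negP := maximal1 Mmax; apply.
  by rewrite -(mulVr Ux) maximalMr.
pose I := [set a * x | a in [set: R]].
have Iprop : proper_ideal_set I.
  apply/proper_idealP; split.
  - by apply/imsetP; exists 0; rewrite ?inE ?mul0r.
  - apply/imsetP=> -[a _ ax]; case/negP: Nx.
    by apply/unitrP; exists a; rewrite [x * a]mulrC -ax.
  - move=> a _ _ /imsetP[u _ ->] /imsetP[v _ ->]; apply/imsetP.
    by exists (a * u + v); rewrite ?inE // mulrDl mulrA.
have [M Mmax sIM] := maxset_exists Iprop.
exists M => //; apply: (subsetP sIM); apply/imsetP; exists 1; rewrite ?inE ?mul1r //.
Qed.

(** [I] is the ideal [M + x R]. Were it proper, maximality would give [I = M], hence [x] in [M]. *)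
Lemma maximal_inv M x : maximal_ideal M -> x \notin M -> exists y, 1 - x * y \in M.
Proof.
move=> Mmax Mx.
pose I := [set z | [exists a, z - x * a \in M]].
have [I1|I1] := boolP (1 \in I); first by move: I1; rewrite inE => /existsP.
have Iprop : proper_ideal_set I.
  apply/proper_idealP; split=> //.
    by rewrite inE; apply/existsP; exists 0; rewrite mulr0 subr0 maximal0.
  move=> a u v; rewrite !inE => /existsP[b Mb] /existsP[c Mc].
  apply/existsP; exists (a * b + c).
  have -> : a * u + v - x * (a * b + c) = a * (u - x * b) + (v - x * c).
    by rewrite mulrDr opprD mulrBr addrACA mulrCA.
  by rewrite maximalD ?maximalMr.
have sMI : M \subset I.
  by apply/subsetP=> z Mz; rewrite inE; apply/existsP; exists 0; rewrite mulr0 subr0.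
have IM : I = M by have [_ H] := maxsetP Mmax; apply: H.
case/negP: Mx; rewrite -IM inE; apply/existsP; exists 1.
by rewrite mulr1 subrr maximal0.
Qed.

Lemma maximal_prime M x y :
  maximal_ideal M -> (x * y \in M) = (x \in M) || (y \in M).
Proof.
move=> Mm; apply/idP/orP => [Mxy|[Mx|My]]; last 2 first.
- exact: maximalMl.
- exact: maximalMr.
have [Mx|Mx] := boolP (x \in M); [by left | right].
have [z Mz] := maximal_inv Mm Mx.
have -> : y = y * (1 - x * z) + z * (x * y).
  by ring.
by apply: maximalD => //; apply: maximalMr.
Qed.

Lemma maximal_eq M M' : maximal_ideal M -> maximal_ideal M' -> M \subset M' -> M = M'.
Proof.
by move=> Mm M'm sMM'; have [_ H] := maxsetP Mm; rewrite (H M') ?maximal_proper.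
Qed.

Lemma jacobsonP x :
  reflect (forall M, maximal_ideal M -> x \in M) (x \in jacobson R).
Proof. exact: bigcapP. Qed.

(* Prime avoidance: a product of elements of the [M'] outside [M] is invertible modulo [M]. *)
Lemma maximal_separate (T : {set {set R}}) M :
  maximal_ideal M -> (forall M', M' \in T -> maximal_ideal M') -> M \notin T ->
  exists2 e, 1 - e \in M & forall M', M' \in T -> e \in M'.
Proof.
move=> Mm Tm MT.
pose c M' := odflt 0 [pick z in M' | z \notin M].
have cP M' : M' \in T -> c M' \in M' /\ c M' \notin M.
  move=> TM'; rewrite /c; case: pickP => [z /andP[]//|nz].
  suff EM : M' = M by rewrite EM (negPf MT) in TM'.
  apply: maximal_eq (Tm _ TM') Mm _; apply/subsetP=> z M'z.
  by have := nz z; rewrite M'z => /negbFE.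
have /(maximal_inv Mm)[y My] : \prod_(M' in T) c M' \notin M.
  apply: (big_ind (fun z => z \notin M)) => [|a b Ma Mb|M' /cP[]//].
    exact: maximal1.
  by rewrite maximal_prime // negb_or Ma.
exists (\prod_(M' in T) c M' * y) => // M' TM'; have [M'c _] := cP M' TM'.
apply: maximalMl; rewrite ?Tm // (bigD1 M') //=.
by apply: maximalMl; rewrite ?Tm.
Qed.

End MaximalIdeals.

(** * The residue field at a maximal ideal, as a finite field *)

Section ResidueField.

Variables (R : finComUnitRingType) (M : {set R}).
Hypothesis Mmax : maximal_ideal M.

(** The proof of maximality is an argument so that the ideal structure declared next, which needs
    it, can be inferred from the predicate. *)
Definition in_maximal of maximal_ideal M : pred R := fun x => x \in M.

HB.instance Definition _ :=
  isIdealr.Build R (in_maximal Mmax) (proper_idealP M (maximal_proper Mmax)).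

Definition maximal_idealr : idealr R := in_maximal Mmax.

Definition residue : Type := {ideal_quot maximal_idealr}.

HB.instance Definition _ := GRing.ComNzRing.on residue.

Definition residue_pi : R -> residue := \pi_({ideal_quot maximal_idealr})%qT.

Lemma residue_piK : cancel (fun k : residue => repr (k : {ideal_quot maximal_idealr})) residue_pi.
Proof. exact: reprK. Qed.

Lemma residue_pi_zmod : zmod_morphism residue_pi.
Proof. exact: rmorphB. Qed.
Lemma residue_pi_monoid : monoid_morphism residue_pi.
Proof. by split; [exact: rmorph1 | exact: rmorphM]. Qed.

HB.instance Definition _ := GRing.isZmodMorphism.Build R residue residue_pi residue_pi_zmod.
HB.instance Definition _ := GRing.isMonoidMorphism.Build R residue residue_pi residue_pi_monoid.

Lemma residue_pi_eq0 x : (residue_pi x == 0) = (x \in M).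
Proof.
have := Quotient.idealrBE maximal_idealr x 0; rewrite subr0 => E.
by rewrite -[x \in M]/(x \in maximal_idealr) E -(rmorph0 residue_pi).
Qed.

HB.instance Definition _ : isCountable residue := CanIsCountable residue_piK.
HB.instance Definition _ : isFinite residue := CanIsFinite residue_piK.

(** Stated for all [k], with 0 as the inverse of 0, so that one choice function satisfies both
    axioms of a field inverse. *)
Lemma residue_inv_subproof (k : residue) :
  exists l : residue, if k == 0 then l == 0 else l * k == 1.
Proof.
have [_|nzk] := eqVneq k 0; first by exists 0.
have := nzk; rewrite -[k]residue_piK residue_pi_eq0.
set x := repr _ => /(maximal_inv Mmax)[y My]; exists (residue_pi y).
by rewrite -rmorphM mulrC eq_sym -subr_eq0 -(rmorph1 residue_pi) -rmorphB residue_pi_eq0.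
Qed.

Definition residue_inv k := xchoose (residue_inv_subproof k).

Lemma residue_mulV k : k != 0 -> residue_inv k * k = 1.
Proof.
move=> nzk; have := xchooseP (residue_inv_subproof k).
by rewrite -/(residue_inv k) (negPf nzk) => /eqP.
Qed.

Lemma residue_inv0 : residue_inv 0 = 0.
Proof. by have := xchooseP (residue_inv_subproof 0); rewrite -/(residue_inv 0) eqxx => /eqP. Qed.

HB.instance Definition _ := GRing.ComNzRing_isField.Build residue residue_mulV residue_inv0.

End ResidueField.

(** * Counting by residues and the Chinese remainder theorem *)

(** The set is partitioned by the value of [f]; the fibre over [b] is the kernel translated by a
    preimage [c] of [b]. *)
Lemma card_surj_preim (A B : finComNzRingType) (f : {rmorphism A -> B}) (P : pred B) :
  (forall b : B, exists a : A, f a == b) ->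
  #|[set a | P (f a)]| = (#|[set a | (f a == 0)%R]| * #|[set b | P b]|)%N.
Proof.
move=> fsurj; rewrite -sum1_card.
rewrite (partition_big f P) /=; last by move=> a; rewrite inE.
rewrite mulnC -sum_nat_const big_set; apply: eq_bigr => b Pb.
have /eqP fs := xchooseP (fsurj b); set c := xchoose _ in fs.
rewrite sum1_card -[RHS](card_imset _ (addIr c)); apply: eq_card => a.
rewrite unfold_in /= inE; apply/andP/imsetP => [[_ /eqP fa]|[x]].
  by exists (a - c); rewrite ?subrK // inE rmorphB fa fs subrr.
by rewrite inE => /eqP fx ->; rewrite rmorphD fx fs add0r eqxx.
Qed.

Section Counting.

Variable R : finComUnitRingType.
Implicit Types (M I X B : {set R}) (T : {set {set R}}) (C : {set R} -> {set R}) (x y : R).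

Lemma residue_pi_surj M (Mm : maximal_ideal M) k : exists x, residue_pi Mm x == k.
Proof. by exists (repr (k : {ideal_quot maximal_idealr Mm})); rewrite residue_piK. Qed.

Lemma card_residue_preim M (Mm : maximal_ideal M) (P : pred (residue Mm)) :
  #|[set x | P (residue_pi Mm x)]| = (#|M| * #|[set k | P k]|)%N.
Proof.
rewrite card_surj_preim; last exact: residue_pi_surj.
by congr (_ * _)%N; apply: eq_card => x; rewrite !inE residue_pi_eq0.
Qed.

Lemma card_residue M (Mm : maximal_ideal M) : #|R| = (#|M| * #|{: residue Mm}|)%N.
Proof.
have := @card_residue_preim M Mm predT.
have -> : [set k | predT k] = [set: residue Mm] by apply/setP=> k; rewrite !inE.
have -> : [set x | predT (residue_pi Mm x)] = [set: R] by apply/setP=> k; rewrite !inE.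
by rewrite !cardsT.
Qed.

(** When [M] is an ideal, this makes [B] a union of cosets of [M], that is, a condition modulo
    [M]. *)
Definition saturated M B := forall x u, x \in B -> u \in M -> x + u \in B.

(** The uniform probability on [R]; independence of conditions becomes a product formula. *)
Definition density B : rat := #|B|%:R / #|R|%:R.

Lemma card_ring_neq0 : #|R|%:R != 0 :> rat.
Proof. by rewrite pnatr_eq0 -lt0n; apply/card_gt0P; exists 0. Qed.

(* If [e] is 0 modulo [I] and 1 modulo [M], the unimodular change of variables
   [(x, b) |-> (x + e (b - x), b - x)] maps [X * B] onto [(X :&: B) * R]. *)
Lemma card_saturatedI I M X B (e : R) :
  (forall r, e * r \in I) -> (forall r, (1 - e) * r \in M) ->
  saturated I X -> saturated M B ->
  (#|X| * #|B| = #|X :&: B| * #|R|)%N.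
Proof.
move=> Ie Me satX satB.
rewrite -cardsT -!cardsX -(@card_imset _ _ (fun p => (p.1 + e * (p.2 - p.1), p.2 - p.1))).
  apply: eq_card => -[z r]; rewrite !inE andbT.
  apply/imsetP/andP => [[[x b]]|[Xz Bz]]; rewrite /= ?inE /=.
    case/andP=> Xx Bb [-> _]; split; first exact: satX.
    have -> : x + e * (b - x) = b + (1 - e) * (x - b) by ring.
    exact: satB.
  exists (z - e * r, z + (1 - e) * r); rewrite ?inE /=; last by congr pair; ring.
  by rewrite satB // andbT -mulrN satX.
move=> [x b] [x' b'] [E1 E2].
have Ex : x = x'.
  have -> : x = (x + e * (b - x)) - e * (b - x) by ring.
  by rewrite E1 E2; ring.
by congr pair => //; move: E2; rewrite Ex => /addIr.
Qed.

(** Conditions modulo distinct maximal ideals are independent. The ideals are removed from [T] one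
    at a time: [maximal_separate] supplies the [e] that [card_saturatedI] needs, with [I] the
    intersection of the remaining ideals. *)
Lemma density_bigcap T C :
  {in T, forall M, maximal_ideal M} -> {in T, forall M, saturated M (C M)} ->
  density (\bigcap_(M in T) C M) = \prod_(M in T) density (C M).
Proof.
have [m] := ubnP #|T|; elim: m T => // m IH T lt_Tm Tm Tsat.
have [->|[M TM]] := set_0Vmem T.
  by rewrite !big_set0 /density cardsT divff ?card_ring_neq0.
have sub M' : M' \in T :\ M -> M' \in T by case/setD1P.
rewrite !(big_setD1 M TM) /= -IH; first last.
- by move=> M' /sub; apply: Tsat.
- by move=> M' /sub; apply: Tm.
- by move: lt_Tm; rewrite (cardsD1 M T) TM.
have [|e Me TMe] := @maximal_separate _ (T :\ M) M (Tm _ TM) (fun M' h => Tm _ (sub M' h)).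
  by rewrite !inE eqxx.
set X := \bigcap_(_ in _) _.
have := @card_saturatedI (\bigcap_(M' in T :\ M) M') M X (C M) e.
rewrite setIC => E; apply: (mulIf card_ring_neq0).
rewrite /density mulfVK ?card_ring_neq0 //.
apply: (mulIf card_ring_neq0).
rewrite -natrM -E.
- rewrite natrM; field; exact: card_ring_neq0.
- move=> r; apply/bigcapP=> M' TM'; apply: maximalMl (TMe _ TM'); exact/Tm/sub.
- by move=> r; apply: maximalMl (Tm _ TM) _ Me.
- move=> x u /bigcapP Xx /bigcapP Iu; apply/bigcapP=> M' TM'.
  by apply: Tsat (sub _ TM') _ _ (Xx _ TM') (Iu _ TM').
- exact: Tsat.
Qed.

(** Each residue class [C M] has non-zero density, so by [density_bigcap] their intersection has
    non-zero density too. *)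
Lemma maximal_CRT T (c : {set R} -> R) :
  {in T, forall M, maximal_ideal M} ->
  exists x, {in T, forall M, x - c M \in M}.
Proof.
move=> Tm; pose C M := [set x | x - c M \in M].
have := @density_bigcap T C Tm.
case: (set_0Vmem (\bigcap_(M in T) C M)) => [->|[x /bigcapP Cx] _]; last first.
  by exists x => M /Cx; rewrite inE.
have Csat : {in T, forall M, saturated M (C M)}.
  by move=> M TM x u; rewrite !inE addrAC => /maximalD; apply; exact: Tm.
move=> /(_ Csat) /eqP; rewrite {1}/density cards0 mul0r eq_sym prodf_seq_eq0.
case/hasP=> M _ /andP[TM]; rewrite /density mulf_eq0 invr_eq0 (negPf card_ring_neq0) orbF.
rewrite pnatr_eq0 => /eqP/card0_eq/(_ (c M)).
by rewrite !inE subrr maximal0 // Tm.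
Qed.

End Counting.

(** * Supports, neighbourhoods and degrees *)

Section Degrees.

Variable R : finComUnitRingType.
Implicit Types (M B : {set R}) (T : {set {set R}}) (C : {set R} -> {set R}) (x y : R).

Definition maximals : {set {set R}} := [set M | maximal_ideal M].

Definition supp x := [set M in maximals | x \notin M].

Definition nbh x := [set y | 1 - x * y \isn't a GRing.unit].

Definition loop x : bool := 1 - x * x \isn't a GRing.unit.

(** Defined on all of [R], radical included, so that residue conditions can count it; [card_adj]
    identifies it with the graph degree at a vertex. *)
Definition degree x : nat := #|nbh x| - loop x.

Lemma maximalsP M : M \in maximals -> maximal_ideal M.
Proof. by rewrite inE. Qed.

Lemma jacobsonE : jacobson R = \bigcap_(M in maximals) M.
Proof. by apply: eq_bigl => M; rewrite inE. Qed.

Lemma supp_eq0 x : (supp x == set0) = (x \in jacobson R).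
Proof.
apply/eqP/jacobsonP => [E M Mm|Jx].
  by have /setP/(_ M) := E; rewrite !inE Mm /= => /negbFE.
by apply/setP=> M; rewrite !inE; apply/negP=> /andP[Mm /negP]; apply; exact: Jx.
Qed.

(** A maximal ideal containing [1 - x * y] cannot contain [x], or it would contain 1. *)
Lemma nbhP x y : reflect (exists2 M, M \in supp x & 1 - x * y \in M) (y \in nbh x).
Proof.
rewrite inE; apply: (iffP (nonunit_maximal _)) => -[M Mm Mxy]; exists M => //.
  rewrite !inE Mm; apply: contra (maximal1 Mm) => Mx.
  have -> : 1 = (1 - x * y) + x * y by ring.
  by apply: maximalD => //; apply: maximalMl.
by move: Mm; rewrite !inE => /andP[].
Qed.

Lemma loopE x : loop x = (x \in nbh x).
Proof. by rewrite inE. Qed.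

Lemma density_neq0 M : maximal_ideal M -> density M != 0.
Proof.
move=> Mm; rewrite mulf_neq0 ?invr_eq0 ?card_ring_neq0 //.
by rewrite pnatr_eq0 -lt0n; apply/card_gt0P; exists 0; exact: maximal0.
Qed.

Lemma card_maximal_setC M : #|~: M| = (#|R| - #|M|)%N.
Proof. by rewrite cardsCs setCK. Qed.

(** The condition says that [y] is the inverse of [x] in the residue field, which singles out one
    coset of [M]. *)
Lemma card_coset_nbh M x :
  maximal_ideal M -> x \notin M -> #|[set y | 1 - x * y \in M]| = #|M|.
Proof.
move=> Mm Mx; have nzx : residue_pi Mm x != 0 by rewrite residue_pi_eq0.
rewrite -[RHS]muln1 -(cards1 (residue_pi Mm x)^-1).
have -> : [set (residue_pi Mm x)^-1] = [set k | pred1 (residue_pi Mm x)^-1 k].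
  by apply/setP=> k; rewrite !inE.
rewrite -card_residue_preim; apply: eq_card => y; rewrite !inE.
rewrite -residue_pi_eq0 rmorphB rmorph1 rmorphM subr_eq0 /=.
by rewrite -[RHS](inj_eq (mulfI nzx)) mulfV // eq_sym.
Qed.

(** The complement of [nbh x] requires, at each [M] in [supp x], that [y] avoid one coset of [M];
    these conditions are independent. *)
Lemma card_nbh x :
  #|nbh x|%:R = #|R|%:R * (1 - \prod_(M in supp x) (1 - density M)) :> rat.
Proof.
have nz := card_ring_neq0 R.
pose C M := ~: [set y | 1 - x * y \in M].
have suppM : {in supp x, forall M, maximal_ideal M /\ x \notin M}.
  by move=> M; rewrite !inE => /andP[].
have nE : ~: nbh x = \bigcap_(M in supp x) C M.
  apply/setP=> y; rewrite in_setC; apply/idP/bigcapP => [nN M TM|yC].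
    by rewrite !inE; apply: contra nN => Mxy; apply/nbhP; exists M.
  by apply/nbhP=> -[M /yC]; rewrite !inE => /negP.
have -> : \prod_(M in supp x) (1 - density M) = density (~: nbh x).
  rewrite nE density_bigcap.
  - apply: eq_bigr => M /suppM[Mm Mx]; rewrite /density card_maximal_setC.
    rewrite card_coset_nbh // natrB ?max_card //; field; exact: nz.
  - by move=> M /suppM[].
  - move=> M /suppM[Mm _] y u; rewrite !inE => My Mu; apply: contra My => My.
    have -> : 1 - x * y = 1 - x * (y + u) + x * u by ring.
    by apply: maximalD => //; apply: maximalMr.
rewrite /density card_maximal_setC natrB ?max_card //; field; exact: nz.
Qed.

Definition cell T C := \bigcap_(M in maximals) (if M \in T then C M else M).

(** The cell and the radical are both intersections over all maximal ideals. [density_bigcap]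
    computes both, and the factors at ideals outside [T] coincide. *)
Lemma card_cell T C :
  T \subset maximals -> {in T, forall M, saturated M (C M)} ->
  #|cell T C|%:R = #|jacobson R|%:R * \prod_(M in T) (#|C M|%:R / #|M|%:R) :> rat.
Proof.
move=> /subsetP Tm Csat; have nz := card_ring_neq0 R.
apply: (mulIf (invr_neq0 nz)); rewrite -[LHS]/(density _).
rewrite density_bigcap; first last.
- move=> M /maximalsP Mm; case: ifP => [/Csat//|_] x u Mx Mu.
  exact: maximalD.
- by move=> M /maximalsP.
rewrite mulrAC -[X in _ = X * _]/(density _) jacobsonE density_bigcap; first last.
- by move=> M /maximalsP Mm x u; apply: maximalD.
- by move=> M /maximalsP.
have -> : \prod_(M in T) (#|C M|%:R / #|M|%:R) =
          \prod_(M in maximals) (if M \in T then (#|C M|%:R / #|M|%:R) else 1) :> rat.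
  rewrite -big_mkcondr; apply: eq_bigl => M; rewrite andbC.
  by case TM: (M \in T) => //=; rewrite Tm.
rewrite -big_split; apply: eq_bigr => M /maximalsP/density_neq0.
case: ifP => _; rewrite ?mulr1 //= /density => nzM; field; last exact: nz.
by rewrite nz andbT; apply: contraNneq nzM => ->; rewrite mul0r.
Qed.

Definition support_class T := [set x | supp x == T].
Definition loopless_class T := [set x in support_class T | ~~ loop x].

(** The elements whose residue is non-zero and not its own inverse. *)
Definition nonroots M := [set x | (x \notin M) && (1 - x * x \notin M)].

Lemma support_class_cell T :
  T \subset maximals -> support_class T = cell T (fun M => ~: M).
Proof.
move=> /subsetP Tm; apply/setP=> x; rewrite inE; apply/eqP/bigcapP => [<- M Mm|xC].
  by rewrite inE Mm; case: ifP; rewrite ?inE // => /negbFE.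
apply/setP=> M; have [Mm|Mm] := boolP (M \in maximals); last first.
  by rewrite inE (negPf Mm); apply/esym/negP=> /Tm; apply/negP.
have := xC M Mm; rewrite inE Mm; case: ifP; rewrite ?inE // => _ -> //.
Qed.

Lemma loopless_class_cell T :
  T \subset maximals -> loopless_class T = cell T nonroots.
Proof.
move=> Tm; apply/setP=> x; rewrite inE support_class_cell // loopE.
apply/andP/bigcapP => [[/bigcapP xC nx] M Mm|xC].
  have := xC M Mm; case: ifP => // TM; rewrite !inE => Mx; rewrite Mx /=.
  by apply: contra nx => M1; apply/nbhP; exists M => //; rewrite inE Mm.
have xE : x \in cell T (fun M => ~: M).
  by apply/bigcapP=> M /xC; case: ifP; rewrite ?inE // => _ /andP[].
split=> //; apply/nbhP=> -[M xM Mxx].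
have := xE; rewrite -support_class_cell // inE => /eqP Ex.
have := xC M; rewrite -Ex xM !inE Mxx andbF.
by move: xM; rewrite inE => /andP[Mm _] /(_ (maximalsP Mm)).
Qed.

Lemma card_support_class T : T \subset maximals ->
  #|support_class T|%:R =
  #|jacobson R|%:R * \prod_(M in T) (#|~: M|%:R / #|M|%:R) :> rat.
Proof.
move=> Tm; rewrite support_class_cell // card_cell // => M TM x u.
rewrite !inE => Mx Mu; apply: contra Mx => Mxu.
have Mm := maximalsP (subsetP Tm _ TM); by rewrite -[x](addrK u) maximalB.
Qed.

Lemma card_loopless_class T : T \subset maximals ->
  #|loopless_class T|%:R =
  #|jacobson R|%:R * \prod_(M in T) (#|nonroots M|%:R / #|M|%:R) :> rat.
Proof.
move=> Tm; rewrite loopless_class_cell // card_cell // => M TM x u.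
have Mm := maximalsP (subsetP Tm _ TM).
rewrite !inE => /andP[Mx Mxx] Mu; apply/andP; split.
  by apply: contra Mx => Mxu; rewrite -[x](addrK u) maximalB.
apply: contra Mxx => Mxu.
have -> : 1 - x * x = 1 - (x + u) * (x + u) + (x + x + u) * u by ring.
by apply: maximalD => //; apply: maximalMr.
Qed.

Definition profile T k := #|[set x in support_class T | degree x == k]|.

(** The degree takes only two values on the class, [a] at elements without a loop and [a - 1] at the
    others. *)
Lemma profileE T k a :
  {in support_class T, forall x, #|nbh x| = a} ->
  profile T k = ((a == k) * #|loopless_class T| +
                 (a - 1 == k)%N * (#|support_class T| - #|loopless_class T|))%N.
Proof.
move=> Ta; set E := support_class T; set U := loopless_class T.
have sUE : U \subset E by apply/subsetP=> x; rewrite inE => /andP[].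
rewrite /profile -(cardsID U) -[#|E|](cardsID U) (setIidPr sUE) addKn.
congr (_ + _)%N.
  case: eqP => [ak|ak]; rewrite ?mul1n ?mul0n.
    apply: eq_card => x; rewrite inE [x \in [set _ in _ | _]]inE andbC.
    case: (boolP (x \in U)) => //=; rewrite inE => /andP[Ex nlx].
    by rewrite Ex /= /degree Ta // (negPf nlx) subn0 ak eqxx.
  apply: eq_card0 => x; rewrite inE [x \in [set _ in _ | _]]inE.
  apply/negP=> /andP[/andP[Ex /eqP dx]]; rewrite inE => /andP[_ nlx].
  by case: ak; rewrite -dx /degree Ta // (negPf nlx) subn0.
case: eqP => [ak|ak]; rewrite ?mul1n ?mul0n.
  apply: eq_card => x; rewrite !inE; case: (supp x =P T) => [Ex|]; rewrite ?andbF //=.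
  case: (boolP (loop x)) => //= lx; rewrite /degree lx Ta ?ak ?eqxx //.
  by rewrite inE Ex.
apply: eq_card0 => x; rewrite !inE; case: (supp x =P T) => [Ex|]; rewrite ?andbF //=.
case: (boolP (loop x)) => //= lx; rewrite /degree lx Ta ?inE ?Ex //.
by apply/eqP.
Qed.

End Degrees.

(** * Counts that depend only on sizes *)

Section Transport.

Variables (R R' : finComUnitRingType).
Hypotheses (cardR : #|R| = #|R'|) (cardJ : #|jacobson R| = #|jacobson R'|).

(** The condition is read in the residue field, and residue fields of equal size are isomorphic. *)
Lemma card_nonroots (M : {set R}) (M' : {set R'}) :
  maximal_ideal M -> maximal_ideal M' -> #|M| = #|M'| -> #|nonroots M| = #|nonroots M'|.
Proof.
move=> Mm Mm' cardM.
have M_gt0 : (0 < #|M|)%N by apply/card_gt0P; exists 0; exact: maximal0.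
have cardK : #|{: residue Mm}| = #|{: residue Mm'}|.
  apply/eqP; rewrite -(eqn_pmul2l M_gt0) -card_residue {1}cardM.
  by rewrite -card_residue cardR.
have [f f_bij] := finField_iso cardK.
pose P (K : finFieldType) : pred K := fun k => (k != 0) && (1 - k * k != 0).
have rootsE (S : finComUnitRingType) (N : {set S}) (Nm : maximal_ideal N) :
    #|nonroots N| = (#|N| * #|[set k | P (residue Nm) k]|)%N.
  rewrite -card_residue_preim; apply: eq_card => x; rewrite !inE /P.
  by rewrite -(rmorph1 (residue_pi Nm)) -rmorphM -rmorphB !residue_pi_eq0.
rewrite !rootsE cardM; congr (_ * _)%N.
rewrite -(card_imset _ (bij_inj f_bij)); apply: eq_card => k.
have [g fK gK] := f_bij; rewrite -[k]gK mem_imset ?inE; last exact: bij_inj.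
by rewrite /P fmorph_eq0 -(rmorph1 f) -rmorphM -rmorphB fmorph_eq0.
Qed.

(** By [card_nbh], [card_support_class] and [card_loopless_class], the counts entering [profileE]
    depend only on the sizes of the ring, of its radical and of the members of the support. *)
Lemma profile_transport (T : {set {set R}}) (s : {set R} -> {set R'}) k :
  T \subset maximals R -> {in T &, injective s} ->
  {in T, forall M, maximal_ideal (s M) /\ #|s M| = #|M|} ->
  profile T k = profile (s @: T) k.
Proof.
move=> Tm s_inj sP.
have sTm : s @: T \subset maximals R'.
  by apply/subsetP=> _ /imsetP[M TM ->]; rewrite inE; case: (sP M TM).
have nat_inj : injective (fun n : nat => n%:R : rat) by exact: (mulrIn (oner_neq0 _)).
have E1 : #|support_class T| = #|support_class (s @: T)|.
  apply: nat_inj; rewrite !card_support_class // cardJ big_imset //=.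
  congr (_ * _); apply: eq_bigr => M TM; have [_ sM] := sP M TM.
  by rewrite !card_maximal_setC sM cardR.
have E2 : #|loopless_class T| = #|loopless_class (s @: T)|.
  apply: nat_inj; rewrite !card_loopless_class // cardJ big_imset //=.
  congr (_ * _); apply: eq_bigr => M TM; have [Mm' sM] := sP M TM.
  by rewrite sM (card_nonroots (maximalsP (subsetP Tm _ TM)) Mm').
have aE x x' : x \in support_class T -> x' \in support_class (s @: T) ->
    #|nbh x| = #|nbh x'|.
  rewrite !inE => /eqP xT /eqP xT'; apply: nat_inj.
  rewrite !card_nbh xT xT' cardR big_imset //=; congr (_ * (_ - _)).
  by apply: eq_bigr => M TM; have [_ sM] := sP M TM; rewrite /density sM cardR.
(* An empty class offers no element from which to read the common size of [nbh]; any value, here 0,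
   then fits [profileE]. *)
have [ET|[x xT]] := set_0Vmem (support_class T).
  have ET' : support_class (s @: T) = set0.
    by apply/eqP; rewrite -cards_eq0 -E1 ET cards0.
  by rewrite (@profileE _ T k 0) ?(@profileE _ (s @: T) k 0) ?E1 ?E2 // => y; rewrite ?ET ?ET' inE.
have /card_gt0P[x' xT'] : (0 < #|support_class (s @: T)|)%N.
  by rewrite -E1; apply/card_gt0P; exists x.
rewrite (@profileE _ T k #|nbh x|) ?(@profileE _ (s @: T) k #|nbh x|) ?E1 ?E2 //.
  by move=> y' yT'; rewrite (aE x y').
by move=> y yT; rewrite (aE y x') // (aE x x').
Qed.

End Transport.

(** * Elements of a given degree and their possible supports *)

Section DegreeCounts.

Variable R : finComUnitRingType.
Implicit Types (M B : {set R}) (T : {set {set R}}) (x y : R).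

Lemma supp_maximals x : supp x \subset maximals R.
Proof. by apply/subsetP=> M; rewrite inE => /andP[]. Qed.

Lemma suppP M x : M \in supp x -> maximal_ideal M /\ x \notin M.
Proof. by rewrite !inE => /andP[]. Qed.

(** The coset of inverses of [x] modulo [M] lies in [nbh x]. *)
Lemma card_nbh_ge M x : M \in supp x -> (#|M| <= #|nbh x|)%N.
Proof.
move=> xM; have [Mm Mx] := suppP xM.
rewrite -(card_coset_nbh Mm Mx); apply/subset_leq_card/subsetP=> y.
by rewrite inE => Mxy; apply/nbhP; exists M.
Qed.

(** If [supp x] had another member [M'], take [e] in [M] congruent to 1 modulo [M'], and [z] inverse
    to [x] modulo [M']. Then [e * z] is in [nbh x] but outside the coset of inverses of [x] modulo
    [M], so [nbh x] has more than [#|M|] elements. *)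
Lemma supp1 M x : M \in supp x -> (#|nbh x| <= #|M|)%N -> supp x = [set M].
Proof.
move=> xM le_xM; have [Mm Mx] := suppP xM.
apply/setP=> M'; rewrite [RHS]inE; apply/idP/eqP => [xM'|->//].
have [M'm M'x] := suppP xM'; apply/eqP; apply: contraLR le_xM => neM.
have [//||e M'e Me] := @maximal_separate _ [set M] M' M'm.
- by move=> N /set1P->.
- by rewrite inE.
have [z M'z] := maximal_inv M'm M'x.
rewrite -ltnNge -(card_coset_nbh Mm Mx); apply: proper_card.
apply/properP; split.
  by apply/subsetP=> y; rewrite inE => Mxy; apply/nbhP; exists M.
exists (e * z).
  apply/nbhP; exists M' => //.
  have -> : 1 - x * (e * z) = (1 - e) + e * (1 - x * z) by ring.
  by apply: maximalD => //; apply: maximalMr.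
rewrite inE; apply: contra (maximal1 Mm) => M1.
have -> : 1 = (1 - x * (e * z)) + (x * z) * e by ring.
by apply: maximalD => //; apply: maximalMr => //; apply: Me; rewrite inE.
Qed.

(** The witness [e] is 1 modulo [M] and 0 modulo every other maximal ideal. Its neighbourhood is a
    single coset of [M], and its loop lowers the degree by 1. *)
Lemma profile_set1_gt0 M : maximal_ideal M -> (0 < profile [set M] (#|M| - 1))%N.
Proof.
move=> Mm.
have [||e Me eM] := @maximal_separate _ (maximals R :\ M) M Mm.
- by move=> N /setD1P[_ /maximalsP].
- by rewrite !inE eqxx.
have M_e : e \notin M.
  apply: contra (maximal1 Mm) => eM1.
  by rewrite -[1](subrK e); apply: maximalD.
have suppe : supp e = [set M].
  apply/setP=> N; rewrite !inE; apply/andP/eqP => [[Nm Ne]|->//].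
  by apply: contraNeq Ne => neNM; apply: eM; rewrite !inE neNM.
apply/card_gt0P; exists e; rewrite !inE suppe eqxx /=.
have -> : degree e = (#|M| - 1)%N; last exact: eqxx.
rewrite /degree; congr (_ - _)%N.
  rewrite -(card_coset_nbh Mm M_e); apply: eq_card => y; rewrite [RHS]inE.
  apply/nbhP/idP => [[N]|My]; first by rewrite suppe => /set1P->.
  by exists M; rewrite ?suppe ?inE.
suff -> : loop e by []; rewrite loopE; apply/nbhP; exists M; rewrite ?suppe ?inE //.
have -> : 1 - e * e = (1 + e) * (1 - e) by ring.
exact: maximalMr.
Qed.

(** Some [M] in [T] has size at least [s], while degree [s - 1] leaves at most [s] elements in
    [nbh x]. With [card_nbh_ge] this forces [#|nbh x| = #|M| = s], and [supp1] applies. *)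
Lemma profile_high T s : (0 < s)%N -> T \subset maximals R ->
  ~~ (T \subset [set M in maximals R | (#|M| < s)%N]) ->
  (0 < profile T (s - 1))%N ->
  T \in set1 @: [set M in maximals R | #|M| == s].
Proof.
move=> s_gt0 Tm /subsetPn[M TM]; rewrite inE (subsetP Tm) //= -leqNgt => le_sM.
case/card_gt0P=> x; rewrite !inE => /andP[/eqP xT /eqP dx].
have xM : M \in supp x by rewrite xT.
have le_Mx := card_nbh_ge xM; move: dx; rewrite /degree => dx.
have [le_xM Ms] : (#|nbh x| <= #|M|)%N /\ #|M| = s.
  by move: dx le_Mx le_sM s_gt0; case: (loop x) => /=; move: #|nbh x| #|M|; lia.
apply/imsetP; exists M; last by rewrite -xT; apply: supp1.
by rewrite inE (subsetP Tm) //= Ms.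
Qed.

Definition degree_count k := #|[set x : R | degree x == k]|.

Lemma degree_countE k :
  degree_count k = (\sum_(T in powerset (maximals R)) profile T k)%N.
Proof.
rewrite /degree_count -sum1_card.
rewrite (partition_big (@supp R) (fun T => T \in powerset (maximals R))) /=; last first.
  by move=> x _; rewrite powersetE supp_maximals.
apply: eq_bigr => T _; rewrite sum1_card; apply: eq_card => x.
by rewrite !inE unfold_in /= !inE andbC.
Qed.

(** By [profile_high], a support with a member of size at least [s] contributes only if it is a
    singleton whose member has size [s]. *)
Lemma degree_count_split s : (0 < s)%N ->
  degree_count (s - 1)%N =
  (\sum_(T in powerset [set M in maximals R | (#|M| < s)%N]) profile T (s - 1) +
   \sum_(M in [set M in maximals R | #|M| == s]) profile [set M] (s - 1))%N.
Proof.
move=> s_gt0; rewrite degree_countE.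
set L := [set M in _ | (_ < s)%N]; set S := [set M in _ | _ == s].
rewrite (bigID (fun T => T \subset L)) /=; congr (_ + _)%N.
  apply: eq_bigl => T; rewrite !powersetE andb_idl // => sTL.
  by apply: subset_trans sTL _; apply/subsetP=> M; rewrite inE => /andP[].
rewrite -(big_imset (h := set1) (fun T => profile T (s - 1)%N)) /=; last first.
  by move=> M N _ _; apply: set1_inj.
rewrite big_mkcond [RHS]big_mkcond; apply: eq_bigr => T _.
case: imsetP => [[M SM ->]|nTS].
  move: SM; rewrite inE => /andP[Mm /eqP Ms].
  by rewrite powersetE !sub1set Mm /= inE Mm Ms ltnn.
case: ifP => // /andP[]; rewrite powersetE => Tm nTL.
apply/eqP; rewrite -leqn0 leqNgt; apply/negP=> P_gt0; case: nTS.
exact/imsetP/profile_high.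
Qed.

Lemma degree_jacobson x : x \in jacobson R -> degree x = 0%N.
Proof.
move=> Jx; rewrite /degree (_ : nbh x = set0) ?cards0 //.
apply/setP=> y; rewrite in_set0; apply/nbhP=> -[M].
by have := Jx; rewrite -supp_eq0 => /eqP->; rewrite inE.
Qed.

Lemma card_vertex : #|jacobson_vertex R| = (#|R| - #|jacobson R|)%N.
Proof.
by rewrite card_sig -(cardsC (jacobson R)) addKn; apply: eq_card => x; rewrite !inE.
Qed.

(** No [y] in the radical lies in [nbh x], since [1 - x * y] in [M] would put 1 in [M]; so [nbh x]
    without [x] consists of vertices. *)
Lemma card_adj (v : jacobson_graph R) : #|[set w | adj v w]| = degree (val v).
Proof.
case: v => x Jx; rewrite /degree /=.
rewrite -(card_imset _ val_inj).
have -> : val @: [set w : jacobson_graph R | adj (exist _ x Jx : jacobson_graph R) w] = nbh x :\ x.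
  apply/setP=> y; apply/imsetP/setD1P => [[w]|[neyx xy]].
    rewrite inE => /andP[nxw xw ->]; rewrite inE; split=> //.
    by rewrite eq_sym.
  have Jy : y \notin jacobson R.
    apply/negP=> /jacobsonP Jy; case/nbhP: xy => M /suppP[Mm _] Mxy.
    have /negP := maximal1 Mm; apply.
    have -> : 1 = (1 - x * y) + x * y by ring.
    by apply: maximalD => //; apply: maximalMr => //; apply: Jy.
  exists (exist _ y Jy) => //; rewrite inE; apply/andP; split; first by rewrite eq_sym.
  by move: xy; rewrite inE.
by rewrite (cardsD1 x (nbh x)) -loopE addKn.
Qed.

Definition vertex_count k := #|[set v : jacobson_graph R | #|[set w | adj v w]| == k]|.

(** Elements of the radical have degree 0. This ties the counts by support to [vertex_count], which
    graph isomorphisms preserve. *)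
Lemma degree_count_vertex k :
  degree_count k = (vertex_count k + (k == 0%N) * #|jacobson R|)%N.
Proof.
rewrite /degree_count -(cardsID (jacobson R)) addnC; congr (_ + _)%N.
  rewrite /vertex_count -(card_imset _ val_inj); apply: eq_card => x.
  rewrite !inE; apply/andP/imsetP => [[Jx dx]|[v]].
    by exists (exist _ x Jx) => //; rewrite inE card_adj.
  by rewrite inE card_adj => dv ->; split=> //; exact: (valP v).
case: eqP => [->|nk]; rewrite ?mul1n ?mul0n.
  by apply: eq_card => x; rewrite !inE andb_idl // => /degree_jacobson ->.
apply: eq_card0 => x; rewrite !inE; apply/negP=> /andP[/eqP dx /degree_jacobson d0].
by case: nk; rewrite -dx.
Qed.

End DegreeCounts.

(** * Sizes determined by the graph *)

Lemma exists_min_maximal (R : finComUnitRingType) :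
  exists2 M : {set R}, maximal_ideal M & forall N : {set R}, maximal_ideal N -> (#|M| <= #|N|)%N.
Proof.
have [M0 M0m _] := maxset_exists (proper_ideal0 R).
by case: (@arg_minnP _ M0 (@maximal_ideal R) (fun M => #|M|) M0m) => M; exists M.
Qed.

Lemma vertex_count_gt0 (R : finComUnitRingType) (M : {set R}) :
  maximal_ideal M -> (0 < vertex_count R (#|M| - 1))%N.
Proof.
move=> Mm; have /card_gt0P[x] := profile_set1_gt0 Mm.
rewrite !inE => /andP[/eqP xM /eqP dx].
have Jx : x \notin jacobson R.
  by rewrite -supp_eq0 xM; apply/set0Pn; exists M; rewrite inE.
by apply/card_gt0P; exists (exist _ x Jx); rewrite inE card_adj dx.
Qed.

(** Any [M] in the support of such a vertex will do: [#|M|] is at most the size of the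
    neighbourhood, which exceeds the degree by at most 1. *)
Lemma vertex_count_bound (R : finComUnitRingType) k :
  (0 < vertex_count R k)%N -> exists2 M : {set R}, maximal_ideal M & (#|M| <= k.+1)%N.
Proof.
case/card_gt0P=> v; rewrite inE card_adj => /eqP dv.
have := valP v; rewrite -supp_eq0 => /set0Pn[M vM].
have [Mm _] := suppP vM; exists M => //; apply: leq_trans (card_nbh_ge vM) _.
by rewrite -dv /degree -[X in (_ <= X)%N]add1n -leq_subLR leq_sub2l ?leq_b1.
Qed.

Lemma jacobson_sub_maximal (R : finComUnitRingType) (M : {set R}) :
  maximal_ideal M -> jacobson R \subset M.
Proof. by move=> Mm; apply: bigcap_inf. Qed.

Section GraphInvariants.

Variables (R R' : finComUnitRingType).
Hypothesis isoG : graph_iso (jacobson_graph R) (jacobson_graph R').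

Lemma card_vertex_iso : #|jacobson_vertex R| = #|jacobson_vertex R'|.
Proof. by case: isoG => f [f_bij _]; apply: bij_eq_card f_bij. Qed.

Lemma vertex_count_iso k : vertex_count R k = vertex_count R' k.
Proof.
have [f [f_bij f_adj]] := isoG; have f_inj := bij_inj f_bij.
rewrite /vertex_count -(card_imset _ f_inj); apply: eq_card => v'.
have [g fK gK] := f_bij; rewrite -[v']gK mem_imset // !inE.
rewrite -(card_imset _ f_inj); congr (_ == _); apply: eq_card => w'.
by rewrite -[w']gK mem_imset // !inE f_adj.
Qed.

End GraphInvariants.

(** [M] yields a vertex of degree [#|M| - 1], which the isomorphism carries to [R']; there it bounds
    the size of some maximal ideal. *)
Lemma min_maximal_le (R R' : finComUnitRingType) (M : {set R}) (M' : {set R'}) :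
  graph_iso (jacobson_graph R) (jacobson_graph R') -> maximal_ideal M ->
  (forall N : {set R'}, maximal_ideal N -> (#|M'| <= #|N|)%N) -> (#|M'| <= #|M|)%N.
Proof.
move=> isoG Mm M'min; have := vertex_count_gt0 Mm; rewrite (vertex_count_iso isoG).
case/vertex_count_bound=> N Nm; rewrite subn1 prednK; first exact/leq_trans/M'min.
by apply/card_gt0P; exists 0; exact: maximal0.
Qed.

Lemma graph_iso_sym (G H : simple_graph) : graph_iso G H -> graph_iso H G.
Proof.
case=> f [[g fK gK] fadj]; exists g; split; first by exists f.
by move=> x y; rewrite -fadj !gK.
Qed.

(** [i] and [j] are congruent modulo [d], and both lie between 1 and [d]. *)
Lemma eq_remainder (a b d i j : nat) : (0 < i <= d)%N -> (0 < j <= d)%N ->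
  (i <= a * d)%N -> (j <= b * d)%N -> (a * d - i = b * d - j)%N -> i = j.
Proof.
wlog le_ab : a b i j / (a <= b)%N.
  move=> W hi hj ha hb E; case: (leqP a b) => [/W|/ltnW/W]; first exact.
  by move=> /(_ j i) H; apply/esym/H.
move=> hi hj ha hb E; have [ab|lt_ab] := eqVneq a b; first by subst; lia.
have : (a.+1 * d <= b * d)%N by rewrite leq_mul2r; apply/orP; right; lia.
by rewrite mulSn; lia.
Qed.

(** In [eq_remainder], [d] is the common least size of a maximal ideal, and [a] and [b] are the
    sizes of the corresponding residue fields. *)
Lemma card_jacobson_ring_iso (R R' : finComUnitRingType) :
  graph_iso (jacobson_graph R) (jacobson_graph R') ->
  #|jacobson R| = #|jacobson R'| /\ #|R| = #|R'|.
Proof.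
move=> isoG.
have [M Mm Mmin] := exists_min_maximal R; have [M' M'm M'min] := exists_min_maximal R'.
have cardM : #|M| = #|M'|.
  apply/eqP; rewrite eqn_leq (min_maximal_le isoG Mm M'min) andbT.
  exact: min_maximal_le (graph_iso_sym isoG) M'm Mmin.
have J_gt0 (S : finComUnitRingType) : (0 < #|jacobson S|)%N.
  by apply/card_gt0P; exists 0; apply/jacobsonP=> N; exact: maximal0.
have leJ (S : finComUnitRingType) : (#|jacobson S| <= #|S|)%N by exact: max_card.
have cardV := card_vertex_iso isoG; rewrite !card_vertex in cardV.
have cardJ : #|jacobson R| = #|jacobson R'|.
  apply: (@eq_remainder #|{: residue Mm}| #|{: residue M'm}| #|M|).
  - by rewrite J_gt0 subset_leq_card ?jacobson_sub_maximal.
  - by rewrite J_gt0 cardM subset_leq_card ?jacobson_sub_maximal.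
  - by rewrite mulnC -card_residue.
  - by rewrite mulnC cardM -card_residue.
  - by rewrite mulnC -card_residue cardV mulnC cardM -card_residue.
split=> //; rewrite -(subnK (leJ R)) -(subnK (leJ R')).
by rewrite cardV cardJ.
Qed.

(** Strong induction on [s]. In [degree_count_split] the sum over smaller ideals is known by
    induction, and the other sum is the wanted number times a positive constant. *)
Lemma card_maximals_iso (R R' : finComUnitRingType) :
  graph_iso (jacobson_graph R) (jacobson_graph R') ->
  forall s, #|[set M in maximals R | #|M| == s]| = #|[set M in maximals R' | #|M| == s]|.
Proof.
move=> isoG; have [cardJ cardR] := card_jacobson_ring_iso isoG.
elim/ltn_ind=> -[_|s IH].
  rewrite !eq_card0 // => M; rewrite !inE; apply/negP=> /andP[Mm];
    by rewrite cards_eq0 => /eqP M0; have := maximal0 Mm; rewrite M0 inE.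
have dE : degree_count R (s.+1 - 1)%N = degree_count R' (s.+1 - 1)%N.
  by rewrite !degree_count_vertex (vertex_count_iso isoG) cardJ.
move: dE; rewrite !degree_count_split //.
set L := [set M in maximals R | (_ < _)%N]; set L' := [set M in maximals R' | (_ < _)%N].
set S := [set M in maximals R | _]; set S' := [set M in maximals R' | _].
have [t [t_inj tL tP]] : exists t : {set R} -> {set R'},
    [/\ {in L &, injective t}, t @: L = L' & {in L, forall M, #|t M| = #|M|}].
  (* Sizes below [s.+1] are matched by induction; the fibres over larger keys are empty. *)
  apply: (@fiber_bij_in _ _ nat L L' (fun M => #|M|) (fun M => #|M|) set0) => k.
  have [lt_ks|le_sk] := ltnP k s.+1; last first.
    by rewrite !eq_card0 // => M; rewrite !inE; apply/negP=> /andP[/andP[_ lt] /eqP Mk];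
      rewrite Mk ltnNge le_sk in lt.
  have small (Q : finComUnitRingType) :
      [set M in [set M in maximals Q | (#|M| < s.+1)%N] | #|M| == k]
      = [set M in maximals Q | #|M| == k].
    apply/setP=> M; rewrite !inE -andbA; congr (_ && _).
    by rewrite andb_idl // => /eqP->.
  by rewrite !small IH.
have Lmax : L \subset maximals R by apply/subsetP=> M; rewrite inE => /andP[].
(* Direct image under [t] is a bijection between the power sets that preserves profiles. *)
have -> : (\sum_(T in powerset L') profile T (s.+1 - 1)%N =
           \sum_(T in powerset L) profile T (s.+1 - 1)%N)%N.
  have -> : powerset L' = (fun T : {set {set R}} => t @: T) @: powerset L.
    apply/setP=> T'; rewrite powersetE; apply/idP/imsetP => [sT'L'|[T]].
      exists [set M in L | t M \in T'].
        by rewrite powersetE; apply/subsetP=> M; rewrite inE => /andP[].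
      apply/setP=> M'; apply/idP/imsetP => [TM'|[M]]; last by rewrite inE => /andP[_ ? ->].
      have := subsetP sT'L' _ TM'; rewrite -tL => /imsetP[M LM EM'].
      by exists M => //; rewrite inE LM -EM'.
    by rewrite powersetE => sTL ->; rewrite -tL imsetS.
  rewrite big_imset /=; last first.
    move=> T1 T2; rewrite !powersetE => s1 s2 E; apply/setP=> M.
    apply/idP/idP => TM.
      have : t M \in t @: T2 by rewrite -E imset_f.
      case/imsetP=> N TN /t_inj -> //; first exact: (subsetP s1).
      exact: (subsetP s2).
    have : t M \in t @: T1 by rewrite E imset_f.
    case/imsetP=> N TN /t_inj -> //; first exact: (subsetP s2).
    exact: (subsetP s1).
  apply: eq_bigr => T; rewrite powersetE => /subsetP sTL; apply/esym.
  apply: (profile_transport cardR cardJ).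
  - by apply: subset_trans Lmax; apply/subsetP.
  - by move=> M N TM TN; apply: t_inj; apply: sTL.
  - move=> M /sTL LM; split; last exact: tP.
    have : t M \in L' by rewrite -tL imset_f.
    by rewrite !inE => /andP[].
move/addnI=> E.
have P_gt0 (Q : finComUnitRingType) (M : {set Q}) :
    M \in [set M in maximals Q | #|M| == s.+1] -> (0 < profile [set M] (s.+1 - 1)%N)%N.
  by rewrite !inE => /andP[Mm /eqP<-]; apply: profile_set1_gt0.
(* An empty side has sum 0 and every term is positive, so the other side is then empty too. *)
have [S0|[M SM]] := set_0Vmem S.
  apply/esym/eqP; rewrite S0 cards0 cards_eq0 -subset0; apply/subsetP=> M' S'M'.
  move: E; rewrite S0 big_set0 (bigD1 M') //= => /esym/eqP; rewrite addn_eq0.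
  by rewrite -[_ == _]negbK -lt0n P_gt0.
have [S0|[M' SM']] := set_0Vmem S'.
  apply/eqP; rewrite S0 cards0 cards_eq0 -subset0; apply/subsetP=> N SN.
  move: E; rewrite S0 big_set0 (bigD1 N) //= => /eqP; rewrite addn_eq0.
  by rewrite -[_ == _]negbK -lt0n P_gt0.
(* [Q] stands for both [R] and [R']: all terms on either side equal the one at a fixed [M] in
   [S]. *)
have PE (Q : finComUnitRingType) (N : {set Q}) : #|R| = #|Q| -> #|jacobson R| = #|jacobson Q| ->
    N \in [set M in maximals Q | #|M| == s.+1] ->
    profile [set N] (s.+1 - 1)%N = profile [set M] (s.+1 - 1)%N.
  move=> cR cJ; rewrite !inE => /andP[Nm /eqP cN].
  move: SM; rewrite !inE => /andP[Mm /eqP cM].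
  rewrite (profile_transport cR cJ (s := fun=> N)) ?imset_set1 ?sub1set ?inE //.
    by move=> M1 M2 /set1P-> /set1P->.
  by move=> M1 /set1P->; rewrite cN cM.
move: E; rewrite (eq_bigr (fun=> profile [set M] (s.+1 - 1)%N)); last by move=> N; apply: PE.
rewrite [RHS](eq_bigr (fun=> profile [set M] (s.+1 - 1)%N)); last first.
  by move=> N; apply: PE.
by rewrite !sum_nat_const => /eqP; rewrite eqn_pmul2r ?P_gt0 // => /eqP.
Qed.

Lemma inj_surj_bij (A B : choiceType) (f : A -> B) :
  injective f -> (forall b, exists a, f a == b) -> bijective f.
Proof.
move=> f_inj f_surj; pose g b := xchoose (f_surj b).
have gK b : f (g b) = b by apply/eqP; exact: (xchooseP (f_surj b)).
by exists g => // a; apply: f_inj.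
Qed.

(** * The quotient by the Jacobson radical *)

Section JacobsonQuotient.

Variable R : finComUnitRingType.

Definition jacobson_pi : R -> jacobson_quot R := \pi_({ideal_quot jacobson_ideal R})%qT.

Lemma jacobson_pi_zmod : zmod_morphism jacobson_pi.
Proof. exact: rmorphB. Qed.
Lemma jacobson_pi_monoid : monoid_morphism jacobson_pi.
Proof. by split; [exact: rmorph1 | exact: rmorphM]. Qed.

HB.instance Definition _ :=
  GRing.isZmodMorphism.Build R (jacobson_quot R) jacobson_pi jacobson_pi_zmod.
HB.instance Definition _ :=
  GRing.isMonoidMorphism.Build R (jacobson_quot R) jacobson_pi jacobson_pi_monoid.

Lemma jacobson_pi_surj b : exists x, jacobson_pi x == b.
Proof. by exists (repr (b : {ideal_quot jacobson_ideal R})); rewrite /jacobson_pi reprK. Qed.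

Lemma jacobson_pi_eq0 x : (jacobson_pi x == 0) = (x \in jacobson R).
Proof.
have := Quotient.idealrBE (jacobson_ideal R) x 0; rewrite subr0 => E.
by rewrite -[x \in jacobson R]/(x \in jacobson_ideal R) E -(rmorph0 jacobson_pi).
Qed.

(** If [x * y - 1] is in the radical, a maximal ideal containing [x] would contain 1. The
    existential expresses invertibility because [jacobson_quot] is only a [comNzRingType]. *)
Lemma unit_jacobson_pi x :
  x \is a GRing.unit <-> exists b, jacobson_pi x * b = 1.
Proof.
split=> [Ux|[b]].
  by exists (jacobson_pi x^-1); rewrite -rmorphM divrr // rmorph1.
have [y /eqP <-] := jacobson_pi_surj b.
rewrite -rmorphM => /eqP; rewrite -subr_eq0 -(rmorph1 jacobson_pi) -rmorphB jacobson_pi_eq0.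
move=> /jacobsonP Jxy; apply: contraT => /nonunit_maximal[M Mm Mx].
case/negP: (maximal1 Mm); have -> : 1 = x * y - (x * y - 1) by ring.
by apply: maximalB; rewrite ?Jxy //; apply: maximalMl.
Qed.

End JacobsonQuotient.

(** * From an isomorphism of quotients to an isomorphism of graphs *)

Lemma card_fiber (R : finComUnitRingType) (B : nzRingType) (f : {rmorphism R -> B}) x0 :
  #|[set x | f x == f x0]| = #|[set x | f x == 0]|.
Proof.
rewrite -[RHS](card_imset _ (addIr x0)); apply: eq_card => x; rewrite inE.
apply/eqP/imsetP => [fx|[z]].
  by exists (x - x0); rewrite ?subrK // inE rmorphB fx subrr.
by rewrite inE => /eqP fz ->; rewrite rmorphD fz add0r.
Qed.

Section QuotientIsoToGraphIso.

Variables (R R' : finComUnitRingType) (F : {rmorphism jacobson_quot R -> jacobson_quot R'}).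
Hypotheses (cardJ : #|jacobson R| = #|jacobson R'|) (F_bij : bijective F).

(** Over a non-zero [k], the fibres of both maps to [jacobson_quot R'] are cosets of the radicals,
    which have equal size; over 0 both fibres are empty outside the radicals. *)
Lemma vertex_bijection : exists s : R -> R',
  [/\ {in ~: jacobson R &, injective s}, s @: (~: jacobson R) = ~: jacobson R'
    & {in ~: jacobson R, forall x, jacobson_pi (s x) = F (jacobson_pi x)}].
Proof.
pose p : {rmorphism R -> jacobson_quot R'} := F \o @jacobson_pi R.
have F_inj := bij_inj F_bij.
apply: (@fiber_bij_in _ _ (jacobson_quot R') _ _ p (@jacobson_pi R') 0) => k.
have p0 x : (p x == 0) = (x \in jacobson R).
  by rewrite /p /= -(rmorph0 F) (inj_eq F_inj) jacobson_pi_eq0.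
have [->|nzk] := eqVneq k 0.
  by rewrite !eq_card0 // => x; rewrite !inE ?p0 ?jacobson_pi_eq0 andNb.
have -> : [set x in ~: jacobson R | p x == k] = [set x | p x == k].
  by apply/setP=> x; rewrite !inE andb_idl // => /eqP px; rewrite -p0 px.
have -> : [set x in ~: jacobson R' | jacobson_pi x == k] = [set x | jacobson_pi x == k].
  by apply/setP=> x; rewrite !inE andb_idl // => /eqP px; rewrite -jacobson_pi_eq0 px.
have [y /eqP yk] := jacobson_pi_surj k.
have [G FK GK] := F_bij; have [x /eqP xk] := jacobson_pi_surj (G k).
have px : p x = k by rewrite /p /= xk GK.
rewrite -{1}px -yk !card_fiber.
rewrite (eq_card (B := jacobson R)); last by move=> z; rewrite inE p0.
by rewrite cardJ; apply: eq_card => z; rewrite inE jacobson_pi_eq0.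
Qed.

(** Whether [1 - x * y] is a unit depends only on its class modulo the radical. *)
Lemma quotient_iso_graph_iso : graph_iso (jacobson_graph R) (jacobson_graph R').
Proof.
have [s [s_inj sJ sP]] := vertex_bijection.
have sJ' (v : jacobson_vertex R) : s (val v) \notin jacobson R'.
  by rewrite -in_setC -sJ imset_f // in_setC (valP v).
pose f (v : jacobson_vertex R) : jacobson_vertex R' := exist _ (s (val v)) (sJ' v).
have vJ (v : jacobson_vertex R) : val v \in ~: jacobson R by rewrite in_setC (valP v).
have f_inj : injective f.
  move=> v w /(congr1 val) svw.
  by apply: val_inj; apply: s_inj (vJ v) (vJ w) svw.
exists f; split.
  apply: inj_card_bij => //; rewrite !card_sig.
  have cE (Q : finComUnitRingType) : #|[pred x | x \notin jacobson Q]| = #|~: jacobson Q|.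
    by apply: eq_card => x; rewrite !inE.
  by rewrite !cE -sJ leq_imset_card.
move=> v w /=; rewrite /jacobson_adj (inj_eq f_inj); congr (_ && ~~ _).
have piE : jacobson_pi (1 - s (val v) * s (val w)) = F (jacobson_pi (1 - val v * val w)).
  by rewrite !rmorphB !rmorphM !rmorph1 /= (sP _ (vJ v)) (sP _ (vJ w)).
apply/idP/idP => /unit_jacobson_pi[b E]; apply/unit_jacobson_pi.
  have [G FK GK] := F_bij; exists (G b); apply: (bij_inj F_bij).
  by rewrite rmorphM GK -piE E rmorph1.
by exists (F b); rewrite piE -rmorphM E rmorph1.
Qed.

End QuotientIsoToGraphIso.

(** * Gluing isomorphisms of residue fields *)

Section Correspondence.

Variables (R R' : finComUnitRingType).

(** An isomorphism from [R / I] to [R' / I'], encoded as a relation on representatives. Such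
    relations for varying ideals share one type, so they can be glued by conjunction. *)
Record correspondence (I : {set R}) (I' : {set R'}) (E : R -> R' -> Prop) : Prop := {
  corr_total : forall x, exists y, E x y;
  corr_onto : forall y, exists x, E x y;
  corr1 : E 1 1;
  corrB : forall x1 y1 x2 y2, E x1 y1 -> E x2 y2 -> E (x1 - x2) (y1 - y2);
  corrM : forall x1 y1 x2 y2, E x1 y1 -> E x2 y2 -> E (x1 * x2) (y1 * y2);
  corr_sub : forall x y, x \in I -> y \in I' -> E x y;
  corr_ker : forall x y, E x y -> (x \in I) = (y \in I') }.

Lemma correspondence_ring_iso E :
  correspondence (jacobson R) (jacobson R') E ->
  ring_iso (jacobson_quot R) (jacobson_quot R').
Proof.
case=> Et Eo E1 EB EM _ Ek; have [h hE] := fin_all_exists Et.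
have E0 : E 0 0 by rewrite -{1}(subrr 1) -(subrr 1); apply: EB.
(* [h x] is an arbitrary choice, but its class modulo the radical is determined by [x]. *)
have uniq x y1 y2 : E x y1 -> E x y2 -> jacobson_pi y1 = jacobson_pi y2.
  move=> e1 e2; apply/eqP; rewrite -subr_eq0 -rmorphB jacobson_pi_eq0.
  rewrite -(Ek 0); last by rewrite -(subrr x); apply: EB.
  by apply/jacobsonP=> M; exact: maximal0.
pose q x := jacobson_pi (h x).
have qB : zmod_morphism q by move=> x y; rewrite /q -rmorphB; apply: uniq (hE _) (EB _ _ _ _ _ _).
have qM : monoid_morphism q.
  split; first by rewrite /q -(rmorph1 (@jacobson_pi R')); apply: uniq (hE _) E1.
  by move=> x y; rewrite /q -rmorphM; apply: uniq (hE _) (EM _ _ _ _ _ _).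
pose Q : {rmorphism R -> jacobson_quot R'} :=
  HB.pack q (GRing.isZmodMorphism.Build _ _ q qB) (GRing.isMonoidMorphism.Build _ _ q qM).
have Qker x : (Q x == 0) = (x \in jacobson R).
  by rewrite jacobson_pi_eq0 (Ek x (h x)).
have [||F FE] := @surj_rmorphism_factor R (jacobson_quot R) (jacobson_quot R') (@jacobson_pi R) Q.
- exact: jacobson_pi_surj.
- by move=> x /eqP; rewrite jacobson_pi_eq0 -Qker => /eqP.
exists F; apply: inj_surj_bij => [a b|b].
  have [x /eqP <-] := jacobson_pi_surj a; have [y /eqP <-] := jacobson_pi_surj b.
  rewrite !FE => /eqP; rewrite -subr_eq0 -rmorphB Qker => Jxy.
  by apply/eqP; rewrite -subr_eq0 -rmorphB jacobson_pi_eq0.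
have [y /eqP <-] := jacobson_pi_surj b; have [x Exy] := Eo y.
by exists (jacobson_pi x); rewrite FE; apply/eqP; apply: uniq (hE _) Exy.
Qed.

Lemma residue_correspondence (M : {set R}) (M' : {set R'}) :
  maximal_ideal M -> maximal_ideal M' -> #|R| = #|R'| -> #|M| = #|M'| ->
  exists E, correspondence M M' E.
Proof.
move=> Mm M'm cardR cardM.
have M_gt0 : (0 < #|M|)%N by apply/card_gt0P; exists 0; exact: maximal0.
have [f f_bij] : exists f : {rmorphism residue Mm -> residue M'm}, bijective f.
  apply: finField_iso; apply/eqP; rewrite -(eqn_pmul2l M_gt0) -card_residue.
  by rewrite cardM -card_residue cardR.
exists (fun x y => f (residue_pi Mm x) = residue_pi M'm y); split.
- move=> x; have [y /eqP yE] := residue_pi_surj (f (residue_pi Mm x)).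
  by exists y.
- move=> y; have [g fK gK] := f_bij.
  have [x /eqP xE] := residue_pi_surj (g (residue_pi M'm y)).
  by exists x; rewrite xE gK.
- by rewrite !rmorph1.
- by move=> x1 y1 x2 y2 e1 e2; rewrite !rmorphB e1 e2.
- by move=> x1 y1 x2 y2 e1 e2; rewrite !rmorphM e1 e2.
- move=> x y; rewrite -(residue_pi_eq0 Mm) -(residue_pi_eq0 M'm).
  by move=> /eqP-> /eqP->; rewrite rmorph0.
- by move=> x y e; rewrite -(residue_pi_eq0 Mm) -(residue_pi_eq0 M'm) -e fmorph_eq0.
Qed.

(** A partner of [x] is chosen for each [M] separately, and the Chinese remainder theorem gives one
    [y] congruent to all of them. Each [E M] only sees residues ([satr], [satl]), so [y] is related
    to [x] at every [M]. *)
Lemma CRT_correspondence (s : {set R} -> {set R'}) (E : {set R} -> R -> R' -> Prop) :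
  {in maximals R &, injective s} -> s @: maximals R = maximals R' ->
  {in maximals R, forall M, correspondence M (s M) (E M)} ->
  correspondence (jacobson R) (jacobson R') (fun x y => {in maximals R, forall M, E M x y}).
Proof.
move=> s_inj sm sE.
(* [t] undoes [s], so that the partners [c M] can be indexed by the ideals of [R']. *)
have [t tP] : exists t : {set R'} -> {set R}, {in maximals R, cancel s t}.
  exists (fun N => odflt set0 [pick M in maximals R | s M == N]) => M Mm.
  case: pickP => [N /andP[Nm /eqP]|/(_ M)]; last by rewrite Mm eqxx.
  by move/s_inj; apply.
have satr M x y z : M \in maximals R -> E M x y -> z - y \in s M -> E M x z.
  move=> Mm Exy sMz; have [_ _ _ EB _ Es _] := sE M Mm.
  have sMm : maximal_ideal (s M) by apply: maximalsP; rewrite -sm imset_f.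
  have e := EB _ _ _ _ Exy (Es 0 (y - z) _ _).
  rewrite -[x]subr0 -[z](subKr y); apply: e; first exact/maximal0/maximalsP.
  by rewrite -opprB maximalN.
have satl M x y z : M \in maximals R -> E M x y -> z - x \in M -> E M z y.
  move=> Mm Exy Mz; have [_ _ _ EB _ Es _] := sE M Mm.
  have sMm : maximal_ideal (s M) by apply: maximalsP; rewrite -sm imset_f.
  have e := EB _ _ _ _ Exy (Es (x - z) 0 _ _).
  rewrite -[y]subr0 -[z](subKr x); apply: e; last exact: maximal0.
  by rewrite -opprB maximalN // maximalsP.
split.
- move=> x; have [c cE] : exists c, forall M, M \in maximals R -> E M x (c M).
    apply: (@fin_all_exists _ (fun=> R') (fun M y => M \in maximals R -> E M x y)) => M.
    have [Mm|Mm] := boolP (M \in maximals R); last by exists 0.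
    by have [Et _ _ _ _ _ _] := sE M Mm; have [y] := Et x; exists y.
  have [y yE] := @maximal_CRT R' (maximals R') (fun N => c (t N)) (fun N => @maximalsP _ N).
  exists y => M Mm; apply: satr (cE M Mm) _ => //.
  by rewrite -{1}(tP M Mm) yE // -sm imset_f.
- move=> y; have [c cE] : exists c, forall M, M \in maximals R -> E M (c M) y.
    apply: (@fin_all_exists _ (fun=> R) (fun M x => M \in maximals R -> E M x y)) => M.
    have [Mm|Mm] := boolP (M \in maximals R); last by exists 0.
    by have [_ Eo _ _ _ _ _] := sE M Mm; have [x] := Eo y; exists x.
  have [x xE] := @maximal_CRT R (maximals R) c (fun N => @maximalsP _ N).
  by exists x => M Mm; apply: satl (cE M Mm) (xE M Mm).
- by move=> M /sE[].
- by move=> x1 y1 x2 y2 e1 e2 M Mm; have [_ _ _ EB _ _ _] := sE M Mm; apply: EB; auto.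
- by move=> x1 y1 x2 y2 e1 e2 M Mm; have [_ _ _ _ EM _ _] := sE M Mm; apply: EM; auto.
- move=> x y /jacobsonP Jx /jacobsonP Jy M Mm; have [_ _ _ _ _ Es _] := sE M Mm.
  by apply: Es; [apply: Jx; exact: maximalsP | apply: Jy; apply: maximalsP; rewrite -sm imset_f].
- move=> x y e; apply/jacobsonP/jacobsonP => J N Nm.
    have : N \in maximals R' by rewrite inE.
    rewrite -sm => /imsetP[M Mm ->]; have [_ _ _ _ _ _ Ek] := sE M Mm.
    by rewrite -(Ek x) ?J //; [exact: maximalsP | exact: e].
  have Nm' : N \in maximals R by rewrite inE.
  have [_ _ _ _ _ _ Ek] := sE N Nm'; rewrite (Ek x y) ?J //; last exact: e.
  by apply: maximalsP; rewrite -sm imset_f.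
Qed.

End Correspondence.

(** [s] pairs maximal ideals of equal size; their residue fields are matched pair by pair and the
    matches glued. *)
Lemma graph_iso_quotient_iso (R R' : finComUnitRingType) :
  graph_iso (jacobson_graph R) (jacobson_graph R') ->
  ring_iso (jacobson_quot R) (jacobson_quot R').
Proof.
move=> isoG; have [cardJ cardR] := card_jacobson_ring_iso isoG.
have [s [s_inj sm sP]] := @fiber_bij_in _ _ nat (maximals R) (maximals R')
  (fun M => #|M|) (fun M => #|M|) set0 (card_maximals_iso isoG).
have [E EP] : exists E, forall M, M \in maximals R -> correspondence M (s M) (E M).
  apply: (@fin_all_exists _ (fun=> R -> R' -> Prop)
    (fun M E => M \in maximals R -> correspondence M (s M) E)) => M.
  (* The choice runs over all subsets of [R]; those that are not maximal ideals get a dummy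
     relation. *)
  have [Mm|Mm] := boolP (M \in maximals R); last by exists (fun _ _ => True).
  have [|E EP] := residue_correspondence (maximalsP Mm) _ cardR (esym (sP M Mm)).
    by apply: maximalsP; rewrite -sm imset_f.
  by exists E.
exact: correspondence_ring_iso (CRT_correspondence s_inj sm EP).
Qed.

Theorem theorem2p1 (R R' : finComUnitRingType) :
  graph_iso (jacobson_graph R) (jacobson_graph R') <->
  #|jacobson R| = #|jacobson R'| /\
  ring_iso (jacobson_quot R) (jacobson_quot R').
Proof.
split=> [isoG|[cardJ [F F_bij]]]; last exact: quotient_iso_graph_iso F_bij.
by split; [case: (card_jacobson_ring_iso isoG) | exact: graph_iso_quotient_iso].
Qed.
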